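(* For any $(a,b,c,\lambda,\delta)\in(\mathbb F^\times)^4\times\mathbb F$ the following are equivalent: (i) the $\triangle_q$-module $W_\lambda^\delta(a,b,c)$ is irreducible; (ii) for every $(\bar a,\bar b,\bar c,\bar\lambda,\bar\delta)\in(\mathbb F^\times)^4\times\mathbb F$ with $(\bar a,\bar b,\bar c,\bar\lambda,\bar\delta)\simeq_{\pm,\mathfrak S_4}(a,b,c,\lambda,\delta)$, one has $\bar\delta\ne0$ or $\bar\lambda^2\notin\{q^{2i}: i=0,1,\dots,d'-2\}$.
   Context: $\mathbb F$ is an algebraically closed field and $q\in\mathbb F^\times$ is a root of unity of order $d$ with $d\notin\{1,2,4\}$; $d'=d$ if $d$ is odd and $d'=d/2$ if $d$ is even. For $x\in\mathbb F$, $\sqrt{x}$ denotes a fixed root of $t^2-x$. The universal Askey–Wilson algebra $\triangle_q$ is the unital associative $\mathbb F$-algebra with generators $A,B,C$ subject to: each of $A+\frac{qBC-q^{-1}CB}{q^2-q^{-2}}$, $B+\frac{qCA-q^{-1}AC}{q^2-q^{-2}}$, $C+\frac{qAB-q^{-1}BA}{q^2-q^{-2}}$ is central; $\alpha,\beta,\gamma$ denote these multiplied by $q+q^{-1}$. For $(a,b,c,\lambda)\in(\mathbb F^\times)^4$ and $i\in\mathbb N$ set $\theta_i=a\lambda^{-1}q^{2i}+a^{-1}\lambda q^{-2i}$, $\theta_i^*=b\lambda^{-1}q^{2i}+b^{-1}\lambda q^{-2i}$, $\varphi_i=a^{-1}b^{-1}\lambda q(q^i-q^{-i})(\lambda^{-1}q^{i-1}-\lambda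 q^{1-i})(q^{-i}-abc\lambda^{-1}q^{i-1})(q^{-i}-abc^{-1}\lambda^{-1}q^{i-1})$. $M_\lambda(a,b,c)$ is the $\triangle_q$-module with basis $\{m_i\}_{i\in\mathbb N}$, $(A-\theta_i)m_i=m_{i+1}$, $(B-\theta_i^* )m_i=\varphi_im_{i-1}$, and $\alpha,\beta,\gamma$ acting as $(b+b^{-1})(c+c^{-1})+(a+a^{-1})(\lambda q+\lambda^{-1}q^{-1})$, $(c+c^{-1})(a+a^{-1})+(b+b^{-1})(\lambda q+\lambda^{-1}q^{-1})$, $(a+a^{-1})(b+b^{-1})+(c+c^{-1})(\lambda q+\lambda^{-1}q^{-1})$. For $\delta\in\mathbb F$, $W_\lambda^\delta(a,b,c)$ is the quotient of $M_\lambda(a,b,c)$ by the submodule spanned by $\{\delta m_i-m_{d'+i}\}_{i\in\mathbb N}$. The group $\{\pm1\}$ acts on $(\mathbb F^\times)^4$ by $(-1)\cdot(a,b,c,\lambda)=(-a,-b,-c,-\lambda)$. The symmetric group $\mathfrak S_4$ acts on the right on the set of $\{\pm1\}$-orbits by $[a,b,c,\lambda](1\,2)=[a,b,c^{-1},\lambda]$, $[a,b,c,\lambda](3\,4)=[a^{-1},b,c,\lambda]$, $[a,b,c,\lambda](2\,3)=[\frac{a}{s},\frac{b}{s},\frac{c}{s},\frac{\lambda}{s}]$ with $s=\sqrt{abc\lambda q}$, where $[\cdot]$ denotes the $\{\pm1\}$-orbit. Write $(a,b,c,\lambda)\approx(\bar a,\bar b,\bar c,\bar\lambda)$ if their $\{\pm1\}$-orbits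 lie in the same $\mathfrak S_4$-orbit. For quintuples, $(a,b,c,\lambda,\delta)\simeq_{\pm,\mathfrak S_4}(\bar a,\bar b,\bar c,\bar\lambda,\bar\delta)$ means $(a,b,c,\lambda)\approx(\bar a,\bar b,\bar c,\bar\lambda)$ and $\delta+a^{d'}\lambda^{-d'}+a^{-d'}\lambda^{d'}=\bar\delta+\bar a^{d'}\bar\lambda^{-d'}+\bar a^{-d'}\bar\lambda^{d'}$. *)

(* Defs.v *)
From HB Require Import structures.
From mathcomp Require Import all_boot all_order all_algebra.
From Stdlib Require Import Relations.
Set Implicit Arguments. Unset Strict Implicit. Unset Printing Implicit Defensive.
Import Order.TTheory GRing.Theory Num.Theory.
Local Open Scope ring_scope.

Section AW.
Variables (F : fieldType) (q : F) (d : nat).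

Definition dprime : nat := if odd d then d else d./2.

Definition qz (n : int) : F := q ^ n.

Definition theta (a lam : F) (i : nat) : F :=
  a / lam * qz (2 * i%:Z) + lam / a * qz (- (2 * i%:Z)).

Definition phi (a b c lam : F) (i : nat) : F :=
  a^-1 * b^-1 * lam * q * (qz i%:Z - qz (- i%:Z))
  * (lam^-1 * qz (i%:Z - 1) - lam * qz (1 - i%:Z))
  * (qz (- i%:Z) - a * b * c / lam * qz (i%:Z - 1))
  * (qz (- i%:Z) - a * b / c / lam * qz (i%:Z - 1)).

(* scalar by which gamma acts on M_lambda(a,b,c) *)
Definition gammaM (a b c lam : F) : F :=
  (a + a^-1) * (b + b^-1) + (c + c^-1) * (lam * q + lam^-1 * q^-1).

(* The underlying space of M_lambda(a,b,c): finitely supported sequences,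
   encoded as polynomials, with m_i := 'X^i. *)
Definition opM (f : nat -> {poly F}) (p : {poly F}) : {poly F} :=
  \sum_(i < size p) p`_i *: f i.

Definition actA (a b c lam : F) : {poly F} -> {poly F} :=
  opM (fun i => theta a lam i *: 'X^i + 'X^(i.+1)).

(* (B - theta*_i) m_i = phi_i m_{i-1}   (phi_0 = 0) *)
Definition actB (a b c lam : F) : {poly F} -> {poly F} :=
  opM (fun i => theta b lam i *: 'X^i + phi a b c lam i *: 'X^(i.-1)).

(* C is determined by the requirement that
   C + (qAB - q^{-1}BA)/(q^2-q^{-2}) acts as gamma/(q+q^{-1}). *)
Definition actC (a b c lam : F) (p : {poly F}) : {poly F} :=
  (gammaM a b c lam / (q + q^-1)) *: p
  - (q ^+ 2 - q ^- 2)^-1 *: (q *: actA a b c lam (actB a b c lam p)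
                         - q^-1 *: actB a b c lam (actA a b c lam p)).

Definition submoduleM (a b c lam : F) (S : {poly F} -> Prop) : Prop :=
  [/\ S 0, (forall u v, S u -> S v -> S (u + v)) &
      (forall (k : F) u, S u -> S (k *: u))] /\
  [/\ (forall u, S u -> S (actA a b c lam u)),
      (forall u, S u -> S (actB a b c lam u)) &
      (forall u, S u -> S (actC a b c lam u))].

Definition Nsub (delta : F) (p : {poly F}) : Prop :=
  exists r : {poly F},
    p = opM (fun i => delta *: 'X^i - 'X^(dprime + i)) r.

(* W = M / N is irreducible: W <> 0, and (correspondence theorem) every
   submodule of M containing N equals N or M. *)
Definition W_irreducible (a b c lam delta : F) : Prop :=
  ~ (forall p, Nsub delta p) /\
  forall S, submoduleM a b c lam S -> (forall p, Nsub delta p -> S p) ->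
    (forall p, S p -> Nsub delta p) \/ (forall p, S p).

(* generators of the {±1} x S4 action on quadruples in (F^x)^4 *)
Definition quad := (F * F * F * F)%type.

Inductive move : quad -> quad -> Prop :=
  | move_sign a b c l : a != 0 -> b != 0 -> c != 0 -> l != 0 ->
      move (a, b, c, l) (- a, - b, - c, - l)
  | move_12 a b c l : a != 0 -> b != 0 -> c != 0 -> l != 0 ->
      move (a, b, c, l) (a, b, c^-1, l)
  | move_34 a b c l : a != 0 -> b != 0 -> c != 0 -> l != 0 ->
      move (a, b, c, l) (a^-1, b, c, l)
  | move_23 a b c l s : a != 0 -> b != 0 -> c != 0 -> l != 0 ->
      s ^+ 2 = a * b * c * l * q ->
      move (a, b, c, l) (a / s, b / s, c / s, l / s).

Definition approx : quad -> quad -> Prop := clos_refl_sym_trans quad move.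

Definition simeq (x y : quad * F) : Prop :=
  let: (a, b, c, l, de) := x in
  let: (a', b', c', l', de') := y in
  approx (a, b, c, l) (a', b', c', l') /\
  de + a ^+ dprime / l ^+ dprime + l ^+ dprime / a ^+ dprime
  = de' + a' ^+ dprime / l' ^+ dprime + l' ^+ dprime / a' ^+ dprime.

End AW.

(* Main.v *)
Require Import Defs.
From HB Require Import structures.
From mathcomp Require Import all_boot all_order all_algebra.
From mathcomp Require Import ring.
From Stdlib Require Import Classical Relations.
Set Implicit Arguments. Unset Strict Implicit. Unset Printing Implicit Defensive.
Import Order.TTheory GRing.Theory Num.Theory.
Local Open Scope ring_scope.

(** Send m_i to the Newton polynomial prod_(k < i) (x - theta_k).  Then A becomes
    multiplication by x and, with x = y + 1/y, B becomes an Askey-Wilson q-difference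
    operator, whose coefficients depend only on b/lam and on the multiset of the four
    parameters a/lam, 1/(a lam), bcq, bq/c, which the moves permute.  W is F[x]/(P), where
    P(y + 1/y) = y^d' + y^-d' - tau and tau = delta + (a/lam)^d' + (a/lam)^-d', so it is
    reducible iff some B-stable ideal (g) has g | P and 0 < deg g < d'.
    Such a g vanishes at t + 1/t for one of the parameters t; move t to
    the position of a/lam, which forces delta = 0.  If r is the largest index such
    that the r-th Newton polynomial divides g, stability of (g) gives phi_r = 0, and one
    more move turns this into lam^2 = q^(2(r-1)).  Conversely, phi_(i+1) = 0 makes the
    ideal of the (i+1)-st Newton polynomial stable. *)

(** * Newton polynomials as a basis of [{poly F}] *)

Section Newton.
Variable F : fieldType.
Implicit Types (f : nat -> {poly F}) (th : nat -> F) (p r h : {poly F}).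

Lemma opM_widen f p n : (size p <= n)%N -> opM f p = \sum_(i < n) p`_i *: f i.
Proof.
move=> le_pn; rewrite /opM (big_ord_widen n (fun i => p`_i *: f i)) // big_mkcond.
apply: eq_bigr => i _; case: ltnP => // le_pi.
by rewrite nth_default ?scale0r.
Qed.

Lemma opM_is_linear f : linear (opM f).
Proof.
move=> k u v; set n := maxn (size u) (size v).
have le_u : (size u <= n)%N by rewrite leq_maxl.
have le_v : (size v <= n)%N by rewrite leq_maxr.
have le_uv : (size (k *: u + v)%R <= n)%N.
  rewrite (leq_trans (size_polyD _ _)) // geq_max le_v andbT.
  exact: leq_trans (size_scale_leq _ _) le_u.
rewrite (opM_widen f le_uv) (opM_widen f le_u) (opM_widen f le_v).
rewrite scaler_sumr -big_split; apply: eq_bigr => i _ /=.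
by rewrite coefD coefZ scalerDl scalerA.
Qed.

HB.instance Definition _ f :=
  GRing.isLinear.Build F {poly F} {poly F} _ (opM f) (opM_is_linear f).

Lemma opMXn f n : opM f 'X^n = f n.
Proof.
rewrite (@opM_widen _ _ n.+1) ?size_polyXn // big_ord_recr /= coefXn eqxx scale1r.
rewrite big1 ?add0r // => i _.
by rewrite coefXn (ltn_eqF (ltn_ord i)) scale0r.
Qed.

Lemma opM_sum f p : opM f p = \sum_(i < size p) p`_i *: f i.
Proof. by []. Qed.

Definition newton th n : {poly F} := \prod_(k < n) ('X - (th k)%:P).

Lemma newton0 th : newton th 0 = 1. Proof. exact: big_ord0. Qed.

Lemma newtonS th n : newton th n.+1 = newton th n * ('X - (th n)%:P).
Proof. exact: big_ord_recr. Qed.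

Lemma eq_newton th th' : th =1 th' -> newton th =1 newton th'.
Proof. by move=> eq_th n; apply: eq_bigr => k _; rewrite eq_th. Qed.

Lemma newton_add th m n :
  newton th (m + n) = newton th m * newton (fun k => th (m + k)%N) n.
Proof.
elim: n => [|n IH]; first by rewrite addn0 newton0 mulr1.
by rewrite addnS !newtonS IH mulrA.
Qed.

Lemma newton_monic th n : newton th n \is monic.
Proof. by apply: monic_prod => k _; exact: monicXsubC. Qed.

Lemma size_newton th n : size (newton th n) = n.+1.
Proof.
by rewrite size_prod_XsubC /index_enum -enumT size_enum_ord.
Qed.

Lemma newton_root th n k : (k < n)%N -> (newton th n).[th k] = 0.
Proof.
move=> lt_kn; rewrite -(subnKC lt_kn) newton_add newtonS !hornerM hornerXsubC.
by rewrite subrr mulr0 mul0r.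
Qed.

Lemma size_opM_newton th p : size (opM (newton th) p) = size p.
Proof.
rewrite /opM; case sz_p: (size p) => [|n]; first by rewrite big_ord0 size_poly0.
have pn0 : p`_n != 0.
  by rewrite -[n]/n.+1.-1 -sz_p -/(lead_coef p) lead_coef_eq0 -size_poly_gt0 sz_p.
rewrite big_ord_recr /= addrC size_polyDl size_scale ?size_newton //.
apply: (leq_ltn_trans (size_sum _ _ _)); rewrite ltnS.
apply/bigmax_leqP => i _.
by rewrite (leq_trans (size_scale_leq _ _)) ?size_newton.
Qed.

Lemma opM_newton_inj th : injective (opM (newton th)).
Proof.
move=> u v uv; apply/eqP; rewrite -subr_eq0 -size_poly_eq0.
by rewrite -(size_opM_newton th) linearB /= uv subrr size_poly0.
Qed.

(** The boolean equality lets [xchoose] extract the coordinates of [p] in the Newton basis. *)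
Lemma opM_newton_surj th p : exists r, opM (newton th) r == p.
Proof.
have [n] := ubnP (size p); elim: n p => // n IH p.
rewrite ltnS leq_eqVlt => /orP [/eqP sz_p | /IH //].
case: n IH sz_p => [_ /eqP | n IH sz_p].
  by rewrite size_poly_eq0 => /eqP ->; exists 0; rewrite linear0.
have [|r /eqP Er] := IH (p - p`_n *: newton th n).
  rewrite ltnS; apply/leq_sizeP => j; rewrite leq_eqVlt coefB coefZ => /orP [/eqP <-|lt_nj].
    have -> : (newton th n)`_n = 1.
      by have /monicP := newton_monic th n; rewrite /lead_coef size_newton.
    by rewrite mulr1 subrr.
  rewrite (@nth_default _ _ p j) ?sz_p // (@nth_default _ _ (newton th n) j) ?size_newton //.
  by rewrite mulr0 subr0.
exists (r + p`_n *: 'X^n).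
by rewrite linearD linearZ /= opMXn Er subrK eqxx.
Qed.

Definition newton_coord th p : {poly F} := xchoose (opM_newton_surj th p).

Lemma newton_coordK th p : opM (newton th) (newton_coord th p) = p.
Proof. exact/eqP/(xchooseP (opM_newton_surj th p)). Qed.

Lemma opM_newtonK th r : newton_coord th (opM (newton th) r) = r.
Proof. by apply: (@opM_newton_inj th); rewrite newton_coordK. Qed.

Lemma newton_coord_is_linear th : linear (newton_coord th).
Proof.
move=> k u v; apply: (@opM_newton_inj th).
by rewrite linearP /= !newton_coordK.
Qed.

HB.instance Definition _ th :=
  GRing.isLinear.Build F {poly F} {poly F} _ (newton_coord th) (newton_coord_is_linear th).

Lemma newton_coord_newton th n : newton_coord th (newton th n) = 'X^n.
Proof. by rewrite -opMXn opM_newtonK. Qed.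

Lemma size_newton_coord th p : size (newton_coord th p) = size p.
Proof. by rewrite -(size_opM_newton th) newton_coordK. Qed.

End Newton.

(** * Stability under an operator, and generators of ideals *)

Definition stable (F : fieldType) (B : {poly F} -> {poly F}) (g : {poly F}) : Prop :=
  forall p, g %| p -> g %| B p.

(** Euclidean descent: if [g0] fails to divide some [p] in [I], then [p %% g0] is a smaller nonzero
    element of [I]. As [I] is an arbitrary predicate, the case split is classical; the generator may
    be 0. *)
Lemma ideal_principal (F : fieldType) (I : {poly F} -> Prop) :
  (forall u v, I u -> I v -> I (u + v)) -> (forall u v, I u -> I (v * u)) ->
  forall g0, I g0 -> exists2 g, I g & forall p, I p -> g %| p.
Proof.
move=> ID IM.
suff nz g0 : g0 != 0 -> I g0 -> exists2 g, I g & forall p, I p -> g %| p.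
  move=> g0 Ig0; have [min_g0 | /not_all_ex_not [p /(imply_to_and (I p)) [Ip /negP ndiv]]] :=
    classic (forall p, I p -> g0 %| p); first by exists g0.
  by apply: (nz p) => //; apply: contraNneq ndiv => ->; rewrite dvdp0.
have [n] := ubnP (size g0); elim: n g0 => // n IH g0 le_g0 g0_n0 Ig0.
have [min_g0 | /not_all_ex_not [p /(imply_to_and (I p)) [Ip /negP ndiv]]] :=
  classic (forall p, I p -> g0 %| p); first by exists g0.
apply: (IH (p %% g0)) => //; first by apply: leq_trans (le_g0 : (size g0 <= n)%N); rewrite ltn_modp.
have Ep : p %% g0 = p + - (p %/ g0) * g0.
  by rewrite {2}(divp_eq p g0) mulNr addrAC subrr add0r.
by rewrite Ep; apply: ID => //; apply: IM.
Qed.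

(** * Submodules of M and W as stable ideals *)

Section NewtonModel.
Variables (F : fieldType) (q : F) (a b c lam : F).

Let th := theta q a lam.
Let ths := theta q b lam.

(* [B], read in the model of M_lambda(a,b,c) where m_i is [newton th i] and [A] is
   multiplication by ['X]. *)
Definition opB (p : {poly F}) : {poly F} :=
  opM (newton th) (actB q a b c lam (newton_coord th p)).

Lemma opB_is_linear : linear opB.
Proof. by move=> k u v; rewrite /opB /actB !linearP. Qed.

HB.instance Definition _ :=
  GRing.isLinear.Build F {poly F} {poly F} _ opB opB_is_linear.

Lemma opB_newton n :
  opB (newton th n) = ths n *: newton th n + phi q a b c lam n *: newton th n.-1.
Proof.
by rewrite /opB newton_coord_newton /actB opMXn linearD !linearZ /= !opMXn.
Qed.

Lemma opM_newton_actB r :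
  opM (newton th) (actB q a b c lam r) = opB (opM (newton th) r).
Proof. by rewrite /opB opM_newtonK. Qed.

Lemma opM_newton_actA r :
  opM (newton th) (actA q a b c lam r) = 'X * opM (newton th) r.
Proof.
rewrite [actA _ _ _ _ _ _]opM_sum [X in _ = _ * X]opM_sum linear_sum mulr_sumr.
apply: eq_bigr => i _; rewrite linearZ /= linearD linearZ /= !opMXn.
rewrite newtonS mulrBr -scalerAr [_ * _%:P]mulrC mul_polyC addrC subrK.
by rewrite [_ * 'X]mulrC.
Qed.

Lemma size_opB p : (size (opB p) <= size p)%N.
Proof.
rewrite /opB size_opM_newton -[leqRHS](size_newton_coord th) /actB /opM.
apply: (leq_trans (size_sum _ _ _)); apply/bigmax_leqP => i _.
rewrite (leq_trans (size_scale_leq _ _)) // (leq_trans (size_polyD _ _)) // geq_max.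
rewrite !(leq_trans (size_scale_leq _ _)) ?size_polyXn //.
by case: (nat_of_ord i) (ltn_ord i) => // j /ltnW.
Qed.

(** Expand [h] in the Newton basis whose nodes start at [th r]; at that node only the constant term
    survives. The range exceeds [size s] by one, so that the term of index 0 can be split off even
    when [s] is 0. *)
Lemma newton_mul_span r h : exists s : {poly F},
  newton th r * h = \sum_(i < (size s).+1) s`_i *: newton th (r + i) /\ h.[th r] = s`_0.
Proof.
set th' := fun k => th (r + k)%N; exists (newton_coord th' h).
have Eh : h = \sum_(i < (size (newton_coord th' h)).+1)
              (newton_coord th' h)`_i *: newton th' i.
  by rewrite -[LHS](newton_coordK th') (opM_widen _ (leqnSn _)).
split.
  rewrite {1}Eh mulr_sumr; apply: eq_bigr => i _.
  by rewrite -scalerAr newton_add.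
rewrite {1}Eh horner_sum big_ord_recl /= newton0 hornerZ hornerC mulr1.
rewrite big1 ?addr0 // => i _; rewrite hornerZ.
have -> : th r = th' 0%N by rewrite /th' addn0.
by rewrite newton_root ?mulr0.
Qed.

(** [opB] lowers the Newton index by at most one, so in the expansion of [newton th r * h] only the
    term of index [r] can leave the ideal of [newton th r]. *)
Lemma opB_newton_mul r h :
  newton th r %| opB (newton th r * h) - (phi q a b c lam r * h.[th r]) *: newton th r.-1.
Proof.
have [s [-> ->]] := newton_mul_span r h.
rewrite big_ord_recl /= addn0 linearD linear_sum linearZ /= opB_newton scalerDr.
have dvdZ k u : newton th r %| k *: (newton th r * u).
  by rewrite scalerAr dvdp_mulr.
rewrite !scalerA [s`_0 * phi _ _ _ _ _ _]mulrC addrAC addrK dvdp_add //.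
  by rewrite -mul_polyC dvdp_mull.
apply: (big_ind (fun u => newton th r %| u)) => [||i _]; rewrite ?dvdp0 //.
  exact: dvdp_add.
rewrite linearZ /= opB_newton addnS /= -addnS !newton_add.
by rewrite scalerDr dvdp_add // ?scalerA dvdZ.
Qed.

Variables (d : nat) (delta : F).
Let d' := dprime d.
Hypothesis th_per : forall i, th (d' + i)%N = th i.
Hypothesis d'_gt0 : (0 < d')%N.

(* The characteristic polynomial of [A] on W_lambda^delta(a,b,c). *)
Definition wpoly : {poly F} := newton th (dprime d) - delta%:P.

Lemma size_wpoly : size wpoly = d'.+1.
Proof.
rewrite /wpoly size_polyDl ?size_newton // size_polyN.
exact: leq_ltn_trans (size_polyC_leq1 _) _.
Qed.

(** By periodicity of [th], m_(d'+i) becomes the d'-th Newton polynomial times the i-th, so the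
    generator delta m_i - m_(d'+i) becomes [- wpoly * newton th i]. *)
Lemma Nsub_wpoly p : Nsub d delta p <-> wpoly %| opM (newton th) p.
Proof.
have E r : opM (newton th) (opM (fun i => delta *: 'X^i - 'X^(dprime d + i)) r)
           = - wpoly * opM (newton th) r.
  rewrite [X in opM _ X = _]opM_sum [X in _ = _ * X]opM_sum linear_sum mulr_sumr; apply: eq_bigr => i _.
  rewrite linearZ linearB linearZ /= !opMXn newton_add.
  have -> : newton (fun k => th (dprime d + k)%N) i = newton th i.
    by apply: eq_bigr => k _; rewrite th_per.
  by rewrite -scalerAr /wpoly opprB mulrBl mul_polyC.
split=> [[r ->] | /dvdpP [h Eh]]; first by rewrite E dvdp_mulr // dvdpNr.
exists (newton_coord th (- h)); apply: (@opM_newton_inj _ th).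
by rewrite E newton_coordK mulrNN mulrC.
Qed.

Lemma opM_newton1 : opM (newton th) 1 = 1.
Proof. by rewrite -[X in opM _ X](expr0 'X) opMXn newton0. Qed.

(** A subspace stable under [A], that is under multiplication by ['X], is an ideal, and stability
    under [C] follows from that under [A] and [B]. *)
Lemma W_irreducibleP :
  W_irreducible q d a b c lam delta <->
  (forall g, g %| wpoly -> stable opB g -> size g = 1%N \/ wpoly %| g).
Proof.
(* W is nonzero: [wpoly] has positive degree, so it does not divide 1. *)
have Hker : ~ forall p, Nsub d delta p.
  move=> /(_ 1) /Nsub_wpoly; rewrite opM_newton1 dvdp1 size_wpoly.
  by rewrite eqSS -leqn0 leqNgt d'_gt0.
split=> [[_ irr] g g_dvd g_st | irr]; last split=> // S [[S0 SD SZ] [SA SB SC]] SN.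
  have [|p /Nsub_wpoly wp||] := irr (fun p => g %| opM (newton th) p).
  - split; split.
    + by rewrite linear0 dvdp0.
    + move=> u v gu gv; by rewrite linearD dvdp_add.
    + move=> k u gu; by rewrite linearZ /= -mul_polyC dvdp_mull.
    + move=> u gu; by rewrite opM_newton_actA dvdp_mull.
    + move=> u gu; by rewrite opM_newton_actB; apply: g_st.
    + move=> u gu; have dA v : g %| opM (newton th) v -> g %| opM (newton th) (actA q a b c lam v).
        by rewrite opM_newton_actA => ?; rewrite dvdp_mull.
      have dB v : g %| opM (newton th) v -> g %| opM (newton th) (actB q a b c lam v).
        by rewrite opM_newton_actB; apply: g_st.
      have dZ k v : g %| v -> g %| k *: v by rewrite -mul_polyC; apply: dvdp_mull.
      rewrite linearB linearZ linearZ linearB !linearZ /=.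
      apply: dvdp_add; apply: (dZ _ _); rewrite ?dvdpNr; first by auto.
      apply: dvdp_add; apply: (dZ _ _); rewrite ?dvdpNr; by auto.
  - exact: dvdp_trans wp.
  - move=> /(_ (newton_coord th g)); rewrite newton_coordK => /(_ (dvdpp _)) H.
    by right; rewrite -[g](newton_coordK th); apply/Nsub_wpoly.
  - move=> /(_ 1); rewrite opM_newton1 dvdp1.
    by move=> /eqP; left.
(* Conversely, the image of [S] in the Newton model is an ideal; its generator is a stable divisor
   of [wpoly]. *)
pose I u := exists2 p, S p & u = opM (newton th) p.
have IM u h : I u -> I (h * u).
  move=> [p Sp ->]; elim/poly_ind: h p Sp => [|h k IH] p Sp.
    by exists 0; rewrite ?mul0r ?linear0.
  have [w Sw Ew] := IH _ (SA _ Sp).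
  exists (w + k *: p); first by apply: SD => //; apply: SZ.
  by rewrite linearD linearZ /= -Ew opM_newton_actA mulrDl mulrA mul_polyC.
have ID u v : I u -> I v -> I (u + v).
  move=> [p Sp ->] [r Sr ->]; exists (p + r); first exact: SD.
  by rewrite linearD.
have I0 : I 0 by exists 0; rewrite ?linear0.
have [g Ig g_min] := ideal_principal ID IM I0.
have SgP p : S p <-> g %| opM (newton th) p.
  split=> [Sp|/dvdpP [h]]; first by apply: g_min; exists p.
  by have [v Sv ->] := IM _ h Ig; move=> /opM_newton_inj ->.
have [|p g_p|/eqP g1|wg] := irr g.
- rewrite -[wpoly](newton_coordK th); apply/SgP/SN/Nsub_wpoly.
  by rewrite newton_coordK.
- rewrite -[p](newton_coordK th) in g_p *; rewrite -opM_newton_actB.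
  exact/SgP/SB/SgP.
- by right=> p; apply/SgP; rewrite (eqp_dvdl _ (_ : g %= 1)) ?dvd1p // -size_poly_eq1.
- by left=> p /SgP gp; apply/Nsub_wpoly; apply: dvdp_trans gp.
Qed.
End NewtonModel.

(** * The substitution x = y + 1/y and the rational identity behind [opB] *)

Definition xof (F : fieldType) (y : F) : F := y + y^-1.

Section Identity.
Variable F : fieldType.

Lemma xofB (y z : F) : y != 0 -> z != 0 ->
  xof y - xof z = - ((1 - z * y) * (1 - z / y) / z).
Proof. by rewrite /xof => y0 z0; field; rewrite y0 z0. Qed.

(** With [k = b / lam], [r = q ^+ i] and [t], [a1], [a2], [a3] the four parameters, this compares,
    up to a common factor, [opB] with the two shift terms on the Newton polynomial of index i+1. The
    choice of [a1] makes the product of the parameters equal to (k q)^2. *)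
Lemma aw_identity (t a2 a3 k q r y : F) :
  t != 0 -> a2 != 0 -> a3 != 0 -> k != 0 -> q != 0 -> r != 0 -> y != 0 ->
  1 - y ^+ 2 != 0 ->
  let a1 := k ^+ 2 * q ^+ 2 / (t * a2 * a3) in
  let Q := r ^+ 2 in
  let N3 x := (1 - a1 * x) * (1 - a2 * x) * (1 - a3 * x) in
  ((k * (q * r) ^+ 2 + (k * (q * r) ^+ 2)^-1) - (k + k^-1)) * ((1 - t * y * Q) * (1 - t * Q / y))
  + (q * r - (q * r)^-1) * (q * r)^-1 * (1 - t * a1 * Q) * (1 - t * a2 * Q) * (1 - t * a3 * Q) / k
  = - (k^-1 * t * (1 - Q * q ^+ 2) / q ^+ 2) *
    (N3 y * (1 - t * y * Q) / (y * (1 - y ^+ 2)) + y * N3 y^-1 * (1 - t * Q / y) / (1 - y^-1 ^+ 2)).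
Proof.
move=> t0 a20 a30 k0 q0 r0 y0 y21 a1 Q N3; rewrite /N3 /a1 /Q.
have y22 : y ^+ 2 - 1 != 0 by rewrite -opprB oppr_eq0.
field.
by rewrite y0 y22 a30 a20 t0 y21 q0 k0 r0.
Qed.
End Identity.

(** * Askey-Wilson operators and their action on Newton polynomials *)

Section AskeyWilson.
Variables (F : closedFieldType) (q : F).

(** These are the nonzero [y] at which neither shift coefficient, [awf] at y or at 1/y, has a
    pole. *)
Definition good (y : F) : bool :=
  [&& y != 0, 1 - y ^+ 2 != 0, 1 - y^-1 ^+ 2 != 0,
      1 - q ^+ 2 * y ^+ 2 != 0 & 1 - q ^+ 2 * y^-1 ^+ 2 != 0].

Definition awf (k : F) (N : {poly F}) (y : F) : F :=
  N.[y] / (k * ((1 - y ^+ 2) * (1 - q ^+ 2 * y ^+ 2))).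

(* [B] is the Askey-Wilson operator in base [q ^+ 2] whose four parameters are the inverses
   of the roots of [N]. *)
Definition is_aw (k : F) (N : {poly F}) (B : {poly F} -> {poly F}) : Prop :=
  forall p y, good y ->
    (B p).[xof y] = (k + k^-1) * p.[xof y]
      + awf k N y * (p.[xof (q ^+ 2 * y)] - p.[xof y])
      + awf k N y^-1 * (p.[xof (q ^+ 2 * y^-1)] - p.[xof y]).

Definition awN (a b c lam : F) : {poly F} :=
  (1 - (a / lam) *: 'X) * (1 - (b * q / c) *: 'X) * (1 - (b * c * q) *: 'X)
  * (1 - (a * lam)^-1 *: 'X).

Lemma goodV y : good y -> good y^-1.
Proof. by rewrite /good invrK invr_eq0 => /and5P [-> -> -> -> ->]. Qed.

Lemma xofV (y : F) : xof y^-1 = xof y.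
Proof. by rewrite /xof invrK addrC. Qed.

Variable t : F.
Hypotheses (q0 : q != 0) (t0 : t != 0).
Let th i := xof (t * q ^+ (2 * i)).

(** The substitution of q^2 y for y moves the factors 1 - t q^(2k) y and 1 - t q^(2k) / y by one
    index in opposite directions, so the product telescopes. The factor 1 - t y stays on the left,
    since it may vanish. *)
Lemma newton_shift i y : y != 0 ->
  (1 - t * y) * (newton th i.+1).[xof (q ^+ 2 * y)]
  = - ((1 - t * y * q ^+ (2 * i)) * (1 - t * y * q ^+ (2 * i) * q ^+ 2)
       * (1 - t / (q ^+ 2 * y)) / (t * q ^+ (2 * i))) * (newton th i).[xof y].
Proof.
move=> y0; have qn n : q ^+ n != 0 by rewrite expf_neq0.
elim: i => [|i IH].
  rewrite newtonS newton0 mul1r hornerXsubC hornerC /th muln0 expr0 !mulr1 xofB //.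
    by field; rewrite t0 y0 q0.
  by rewrite mulf_neq0.
rewrite newtonS hornerM mulrA IH hornerXsubC [in RHS]newtonS hornerM hornerXsubC.
rewrite /th !xofB ?mulf_neq0 // mulnS exprD.
have := qn (2 * i)%N; set Q := q ^+ (2 * i) => Q0.
by field; rewrite t0 Q0 y0 q0.
Qed.

(** The factor 1 - t y of [N] is the one that [newton_shift] requires; the difference then has a
    factor 1 - q^2 y^2, which cancels in the denominator of [awf]. *)
Lemma aw_term (k : F) N N3 i y : k != 0 -> good y -> (forall x, N.[x] = (1 - t * x) * N3 x) ->
  awf k N y * ((newton th i.+1).[xof (q ^+ 2 * y)] - (newton th i.+1).[xof y])
  = (newton th i).[xof y] / (t * q ^+ (2 * i)) *
    (k^-1 * t * (1 - q ^+ (2 * i) * q ^+ 2) / q ^+ 2)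
    * (N3 y * (1 - t * y * q ^+ (2 * i)) / (y * (1 - y ^+ 2))).
Proof.
move=> k0 /and5P [y0 y1 _ y2 _] NE; have Q0 : q ^+ (2 * i) != 0 by rewrite expf_neq0.
rewrite /awf NE; set M := (k * _)^-1; set V := (newton th i.+1).[xof (_ * _)].
have -> u : (1 - t * y) * N3 y * M * (V - u) = N3 y * M * ((1 - t * y) * V - (1 - t * y) * u).
  by ring.
rewrite newton_shift // newtonS hornerM hornerXsubC xofB ?mulf_neq0 // /M.
field.
by rewrite y1 y0 q0 k0 Q0 t0 exprMn y2.
Qed.

End AskeyWilson.

(** * [theta] and [phi] in the variables of the Askey-Wilson operator *)

Section Coefficients.
Variables (F : fieldType) (q : F).
Hypothesis q0 : q != 0.

Lemma thetaE (a lam : F) i : theta q a lam i = xof (a / lam * q ^+ (2 * i)).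
Proof.
rewrite /theta /qz /xof invfM invf_div.
have -> : 2 * i%:Z = (2 * i)%N :> int by rewrite PoszM.
by rewrite -exprnP -exprnN.
Qed.

Lemma phi0 (a b c lam : F) : phi q a b c lam 0 = 0.
Proof. by rewrite /phi /qz oppr0 subrr mulr0 !mul0r. Qed.

Lemma phiS (a b c lam : F) i : a != 0 -> b != 0 -> c != 0 -> lam != 0 ->
  let r := q ^+ i in
  phi q a b c lam i.+1 = - (a / lam * (b / lam) * r ^+ 2)^-1
    * (q * r - (q * r)^-1) * (q * r)^-1 * (1 - r ^+ 2 / lam ^+ 2)
    * (1 - a * b * c * q / lam * r ^+ 2) * (1 - a * b * q / (c * lam) * r ^+ 2).
Proof.
move=> a0 b0 c0 l0 r; have r0 : r != 0 by rewrite expf_neq0.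
rewrite /phi /qz.
have -> : i.+1%:Z - 1 = i%:Z by rewrite -addn1 PoszD addrK.
have -> : 1 - i.+1%:Z = - i%:Z by rewrite -addn1 PoszD opprD addrCA subrr addr0.
rewrite -!exprnP -!exprnN exprS -/r; field.
by rewrite a0 b0 c0 l0 q0 r0.
Qed.

End Coefficients.

(** * [opB] is an Askey-Wilson operator *)

Section OpB.
Variables (F : closedFieldType) (q : F) (a b c lam : F).
Hypotheses (q0 : q != 0) (a0 : a != 0) (b0 : b != 0) (c0 : c != 0) (l0 : lam != 0).

(** By linearity it is enough to treat Newton polynomials. On the constant one both shift terms
    vanish; on the others [aw_term], at y and at 1/y, reduces the claim to [aw_identity]. *)
Lemma opB_aw : is_aw q (b / lam) (awN q a b c lam) (opB q a b c lam).
Proof.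
have t0 : a / lam != 0 by rewrite mulf_neq0 ?invr_neq0.
have k0 : b / lam != 0 by rewrite mulf_neq0 ?invr_neq0.
move=> p y gy; rewrite -[p](newton_coordK (theta q a lam)).
set s := newton_coord _ p; rewrite opM_sum.
rewrite linear_sum !horner_sum -!sumrB !mulr_sumr -!big_split /=.
apply: eq_bigr => i _; move: (s`_i) => z; rewrite linearZ !hornerZ -!mulrBr.
rewrite ![_ * (z * _)]mulrCA -!mulrDr; congr (_ * _).
rewrite /= opB_newton hornerD !hornerZ.
case: (nat_of_ord i) => [|{}i] /=.
  rewrite newton0 !hornerC phi0 // mul0r subrr !mulr0 !addr0 mulr1.
  by rewrite thetaE // muln0 expr0 !mulr1.
rewrite !(eq_newton (thetaE q a lam)).
set N3 := fun x => (1 - (b * q / c) * x) * (1 - (b * c * q) * x) * (1 - (a * lam)^-1 * x).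
have NE x : (awN q a b c lam).[x] = (1 - a / lam * x) * N3 x.
  by rewrite /awN !hornerE.
have /and5P [y0 y1 yV1 _ _] := gy.
rewrite (aw_term q0 t0 i k0 gy NE).
rewrite -(xofV y) (aw_term q0 t0 i k0 (goodV gy) NE) !xofV.
rewrite newtonS hornerM hornerXsubC xofB ?mulf_neq0 ?expf_neq0 ?invr_eq0 //.
set u := (newton _ i).[_]; rewrite thetaE // phiS //.
have bcq0 : b * c * q != 0 by rewrite !mulf_neq0.
have al0 : (a * lam)^-1 != 0 by rewrite invr_neq0 ?mulf_neq0.
have r0 : q ^+ i != 0 by rewrite expf_neq0.
have := aw_identity t0 bcq0 al0 k0 q0 r0 y0 y1; rewrite /=.
have -> : (b / lam) ^+ 2 * q ^+ 2 / (a / lam * (b * c * q) / (a * lam)) = b * q / c.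
  by field; rewrite a0 b0 c0 l0 q0.
rewrite -!/(N3 _) => Id.
have Q2 : q ^+ (2 * i) = (q ^+ i) ^+ 2 by rewrite mulnC exprM.
have Q3 : q ^+ (2 * i.+1) = (q * q ^+ i) ^+ 2 by rewrite mulnC exprM [q ^+ i.+1]exprS.
rewrite Q2 Q3 [a / lam / y * _]mulrAC [a / lam * _ * y]mulrAC.
have -> : N3 y^-1 * (1 - a / lam * q ^+ i ^+ 2 / y) / (y^-1 * (1 - y^-1 ^+ 2))
          = y * N3 y^-1 * (1 - a / lam * q ^+ i ^+ 2 / y) / (1 - y^-1 ^+ 2).
  by rewrite invfM invrK; ring.
apply/eqP; rewrite -subr_eq0; apply/eqP.
move: Id; set T1 := N3 y * _ / _; set T2 := y * N3 _ * _ / _.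
set X := (1 - _ * q ^+ i ^+ 2) * (1 - _ / y).
move: (q ^+ i) r0 => r r0 in T1 T2 X *.
move: T1 T2 X => T1 T2 X /eqP; rewrite -subr_eq0 => /eqP Id.
(* The difference of the two sides is the identity multiplied by -u / (t r^2), with t = a / lam. *)
rewrite -[RHS](mulr0 (- (u / (a / lam * r ^+ 2)))) -Id /xof.
field.
by rewrite a0 b0 c0 l0 q0 r0.
Qed.

End OpB.

(** * Proper stable ideals of an Askey-Wilson operator *)

Section Gauge.
Variables (F : closedFieldType) (q : F).
Hypotheses (q0 : q != 0) (q4 : q ^+ 4 != 1).

Lemma xof_surj (x : F) : exists2 y, y != 0 & xof y = x.
Proof.
have [|y Hy] := @solve_monicpoly F 2 (fun i => if i == 0%N then -1 else x); first by [].
move: Hy; rewrite !big_ord_recl big_ord0 /= expr0 expr1 mulr1 addr0 => Hy.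
have y0 : y != 0.
  apply: contra_eq_neq Hy => ->; rewrite mulr0 addr0 expr0n /=.
  by rewrite eq_sym oppr_eq0 oner_eq0.
exists y => //; rewrite /xof; apply: (mulIf y0); rewrite mulrDl mulVf // -expr2 Hy.
by rewrite addrAC addNr add0r.
Qed.

Lemma goodP (y : F) : y != 0 -> y ^+ 2 - 1 != 0 -> y ^+ 2 - q ^- 2 != 0 ->
  y ^+ 2 - q ^+ 2 != 0 -> good q y.
Proof.
move=> y0 y1 y2 y3; have yy : y ^- 2 != 0 by rewrite invr_eq0 expf_neq0.
have qq : - q ^+ 2 != 0 by rewrite oppr_eq0 expf_neq0.
rewrite /good y0 /=.
have -> : 1 - y ^+ 2 = - (y ^+ 2 - 1) by ring.
have -> : 1 - y^-1 ^+ 2 = (y ^+ 2 - 1) * y ^- 2 by field.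
have -> : 1 - q ^+ 2 * y ^+ 2 = - q ^+ 2 * (y ^+ 2 - q ^- 2) by field.
have -> : 1 - q ^+ 2 * y^-1 ^+ 2 = (y ^+ 2 - q ^+ 2) * y ^- 2 by field.
by apply/and4P; split; rewrite ?oppr_eq0 ?mulf_neq0.
Qed.

(** The excluded values are roots of a fixed nonzero [D]; a nonroot of [(u - v) * D] would be a good
    point where [u] and [v] differ. *)
Lemma eq_poly_good (u v : {poly F}) :
  (forall y, good q y -> u.[y] = v.[y]) -> u = v.
Proof.
move=> uv; apply/eqP; rewrite -subr_eq0; apply/negPn/negP => uv0.
pose D : {poly F} := 'X * ('X^2 - 1%:P) * ('X^2 - (q ^- 2)%:P) * ('X^2 - (q ^+ 2)%:P).
have D0 : D != 0.
  by rewrite monic_neq0 // !monicMl ?monicX // monicXnsubC.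
have /closed_nonrootP [y] : (u - v) * D != 0 by rewrite mulf_neq0.
rewrite rootM negb_or => /andP [ruv rD]; case/negP: ruv; rewrite rootE !hornerE uv ?subrr //.
move: rD; rewrite rootE /D !hornerE !mulf_eq0 !negb_or -!andbA => /and4P [y0 y1 y2 y3].
exact: goodP.
Qed.

Lemma eq_poly_xof (u v : {poly F}) :
  (forall y, good q y -> u.[xof y] = v.[xof y]) -> u = v.
Proof.
move=> uv; apply/eqP; rewrite -subr_eq0; apply/negPn/negP => uv0.
(* At x = y + 1/y this vanishes exactly when y^2 is 1, q^2 or q^-2. *)
pose D : {poly F} := ('X^2 - (xof 1 ^+ 2)%:P) * ('X^2 - (xof q ^+ 2)%:P).
have D0 : D != 0 by rewrite monic_neq0 // !monicMl ?monicXnsubC.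
have /closed_nonrootP [x] : (u - v) * D != 0 by rewrite mulf_neq0.
have [y y0 <-] := xof_surj x.
rewrite rootM negb_or => /andP [ruv rD]; case/negP: ruv; rewrite rootE !hornerE uv ?subrr //.
move: rD; rewrite rootE /D !hornerE mulf_eq0 negb_or => /andP [D1 D2].
apply: goodP => //; [move: D1|move: D2|move: D2]; apply: contraNneq => E; rewrite /xof ?invr1.
- have -> : (y + y^-1) ^+ 2 - (1 + 1) ^+ 2 = (y ^+ 2 - 1) ^+ 2 / y ^+ 2 by field.
  by rewrite E expr0n mul0r.
- have -> : (y + y^-1) ^+ 2 - (q + q^-1) ^+ 2 = (y ^+ 2 - q ^- 2) * (y ^+ 2 - q ^+ 2) / y ^+ 2.
    by field; rewrite q0 y0.
  by rewrite E !mul0r.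
- have -> : (y + y^-1) ^+ 2 - (q + q^-1) ^+ 2 = (y ^+ 2 - q ^- 2) * (y ^+ 2 - q ^+ 2) / y ^+ 2.
    by field; rewrite q0 y0.
  by rewrite E mulr0 mul0r.
Qed.

Lemma is_aw_unique k N (B B' : {poly F} -> {poly F}) :
  is_aw q k N B -> is_aw q k N B' -> B =1 B'.
Proof. by move=> HB HB' p; apply: eq_poly_xof => y gy; rewrite HB // HB'. Qed.

Variables (k : F) (N : {poly F}) (B : {poly F} -> {poly F}).
Hypotheses (k0 : k != 0) (szN : (size N <= 5)%N) (B_aw : is_aw q k N B)
  (szB : forall p, (size (B p) <= size p)%N).

(* [R] is the numerator of the conjugate of [B] by [p]. Conjugation preserves the diagonal
   part of [B], whose pole at [q^-1] pins down the value of the numerator there. *)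
Lemma stable_gauge p : p != 0 -> p %| B p -> p %| B ('X * p) ->
  exists2 R : {poly F}, R.[q^-1] = N.[q^-1] &
    forall y, good q y -> N.[y] * p.[xof (q ^+ 2 * y)] = R.[y] * p.[xof y].
Proof.
(* It suffices that the value at q^-1 is a constant [c0] depending on [N] and [q] alone: for p = 1
   the numerator is [N], so [c0] is N(q^-1). *)
suff main c0 p' : p' != 0 -> p' %| B p' -> p' %| B ('X * p') ->
  c0 = - (q ^+ 2 - q ^- 2)^-1 * (1 - q ^- 2) * 
      (- (q ^+ 2 * N`_0 + N`_4) * (1 + q ^- 2 + q ^- 4) - (q ^+ 2 * N`_1 + N`_3) * q^-1 * (1 + q ^- 2)
       + (N`_0 - (1 + q ^+ 2) * N`_2 + q ^+ 2 * N`_4) * q ^- 2) ->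
  exists2 R : {poly F}, R.[q^-1] = c0 &
    forall y, good q y -> N.[y] * p'.[xof (q ^+ 2 * y)] = R.[y] * p'.[xof y].
  move=> p0 pB pXB; have [R1 R1q HR1] := main _ 1 (oner_neq0 _) (dvd1p _) (dvd1p _) erefl.
  have NR1 : N = R1 by apply: eq_poly_good => y /HR1; rewrite !hornerC !mulr1.
  rewrite [in N.[_]]NR1 R1q. exact: (main _ p p0 pB pXB).
move=> {p}; move: p' => p p0 /dvdpP [r0 Er0] /dvdpP [r1 Er1] c0E.
(* [B] does not raise degrees, so the quotients of B p and B (X p) by p have degree at most 0 and
   1. *)
have sz0 : (size r0 <= 1)%N.
  have [-> | r00] := eqVneq r0 0; first by rewrite size_poly0.
  have := szB p; rewrite Er0 size_mul //.
  have : (0 < size p)%N by rewrite size_poly_gt0.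
  by case: (size p) => // m _; rewrite addnS /= -[leqRHS]add1n leq_add2r.
have sz1 : (size r1 <= 2)%N.
  have [-> | r10] := eqVneq r1 0; first by rewrite size_poly0.
  have := szB ('X * p); rewrite Er1 size_mul // [size (_ * p)%R]size_mul ?polyX_eq0 // size_polyX.
  have : (0 < size p)%N by rewrite size_poly_gt0.
  by case: (size p) => // m _; rewrite !addnS /= -[leqRHS]add2n leq_add2r.
set K := k + k^-1.
have hE := (hornerD, hornerN, hornerZ, hornerM, hornerXn, hornerX, hornerC).
(* [L] is y (r1(x) - x' r0 - K (x - x')), with x = y + 1/y and x' = [xof (q ^+ 2 / y)]. *)
pose L : {poly F} := r1`_1 *: ('X^2 + 1%:P) + r1`_0 *: 'X - r0`_0 *: (q ^- 2 *: 'X^2 + (q ^+ 2)%:P)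
  - (K * (1 - q ^- 2)) *: ('X^2 - (q ^+ 2)%:P).
(* [C] is k (1 - q^2 y^2) (y^2 - q^2) times the sum of [awf] at y and at 1/y; the factor 1 - y^2
   divides out exactly. *)
pose C : {poly F} := - (q ^+ 2 * N`_0 + N`_4) *: (1%:P + 'X^2 + 'X^4)
  - (q ^+ 2 * N`_1 + N`_3) *: ('X * (1%:P + 'X^2))
  + (N`_0 - (1 + q ^+ 2) * N`_2 + q ^+ 2 * N`_4) *: 'X^2.
have q40 : q ^+ 2 - q ^- 2 != 0.
  have -> : q ^+ 2 - q ^- 2 = (q ^+ 4 - 1) * q ^- 2 by field.
  by rewrite mulf_neq0 ?subr_eq0 // invr_eq0 expf_neq0.
exists (- (q ^+ 2 - q ^- 2)^-1 *: (k *: ((1%:P - q ^+ 2 *: 'X^2) * L) + (1 - q ^- 2) *: C)).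
  rewrite hornerZ hornerD hornerZ hornerM.
  have -> : (1%:P - q ^+ 2 *: 'X^2).[q^-1] = 0 by rewrite !hE; field.
  rewrite mul0r mulr0 add0r hornerZ mulrA c0E /C !hE; move: (_ - q ^- 2)^-1 => w; by field.
move=> y gy; have /and5P [y0 y1 yV1 y2 y3] := gy.
have N5 x : N.[x] = N`_0 + N`_1 * x + N`_2 * x ^+ 2 + N`_3 * x ^+ 3 + N`_4 * x ^+ 4.
  by rewrite (horner_coef_wide _ szN) !big_ord_recr big_ord0 /= add0r expr0 mulr1 expr1.
have := B_aw p gy; have := B_aw ('X * p) gy.
rewrite Er0 Er1 !hornerM !hornerX (horner_coef_wide _ sz0) (horner_coef_wide _ sz1).
rewrite !big_ord_recr !big_ord0 /= !add0r expr0 !mulr1 expr1 -/K /awf.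
rewrite /L /C !hE !N5.
move: (p.[xof y]) (p.[xof (q ^+ 2 * y)]) (p.[xof (q ^+ 2 / y)]) => u up um.
rewrite /K /xof => {L C} E2 E1.
move: (r1`_0) (r1`_1) (r0`_0) N`_0 N`_1 N`_2 N`_3 N`_4 E1 E2.
move=> r10 r11 r00 n0 n1 n2 n3 n4 /eqP; rewrite -subr_eq0 => /eqP E1 /eqP.
rewrite -subr_eq0 => /eqP E2.
have y1' : y ^+ 2 - 1 != 0 by rewrite -opprB oppr_eq0.
have y3' : y ^+ 2 - q ^+ 2 != 0.
  have -> : y ^+ 2 - q ^+ 2 = (1 - q ^+ 2 * y^-1 ^+ 2) * y ^+ 2 by field.
  by rewrite mulf_neq0 ?expf_neq0.
have q41 : q ^+ 4 - 1 != 0 by rewrite subr_eq0.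
set c := k * (1 - q ^+ 2 * y ^+ 2) * y / (q ^+ 2 - q ^- 2).
apply/eqP; rewrite -subr_eq0; apply/eqP.
have lin A1 A2 x G : A1 = 0 -> A2 = 0 -> G = c * (A2 - x * A1) -> G = 0.
  by move=> -> -> ->; rewrite mulr0 subr0 mulr0.
(* Subtracting [xof (q ^+ 2 / y)] times the relation for p from that for X p eliminates the value of
   p at [xof (q ^+ 2 / y)]. *)
apply: (lin _ _ (q ^+ 2 / y + (q ^+ 2 / y)^-1) _ E1 E2); rewrite /c.
field.
rewrite y0 y3' y1' k0 exprMn y2 y1 q0 -expr2 -exprM.
by rewrite q41.
Qed.

Definition palin (r : seq F) : {poly F} := \prod_(z <- r) ('X^2 - z *: 'X + 1%:P).

Lemma palinE r y : y != 0 ->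
  (palin r).[y] = y ^+ size r * (\prod_(z <- r) ('X - z%:P)).[xof y].
Proof.
move=> y0; rewrite /palin; elim: r => [|z r IH]; first by rewrite !big_nil !hornerC mulr1.
rewrite !big_cons hornerM IH hornerM /= [y ^+ _.+1]exprS !(hornerD, hornerN, hornerZ, hornerXn, hornerX, hornerC).
by rewrite /xof; field.
Qed.

Lemma palin_monic r : palin r \is monic /\ size (palin r) = (2 * size r).+1.
Proof.
rewrite /palin; elim: r => [|z r [IHm IHs]].
  by rewrite big_nil monic1 size_poly1.
have sz2 : size ('X^2 - z *: 'X + 1%:P) = 3%N.
  rewrite -addrA size_polyDl size_polyXn // ltnS.
  rewrite (leq_trans (size_polyD _ _)) // geq_max size_polyN size_polyC oner_eq0 andbT.
  by rewrite (leq_trans (size_scale_leq _ _)) ?size_polyX.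
have mon2 : 'X^2 - z *: 'X + 1%:P \is monic.
  by rewrite monicE lead_coefE sz2 /= !coefE /= mulr0 subr0 addr0.
rewrite big_cons monicMl // size_monicM ?monic_neq0 // sz2 IHs; split=> //.
by rewrite /= mulnS.
Qed.

Lemma palin_coef0 r : (palin r)`_0 = 1.
Proof.
rewrite -horner_coef0 /palin horner_prod big1 // => z _.
by rewrite !(hornerD, hornerN, hornerZ, hornerXn, hornerX, hornerC) mulr0 subr0 expr0n add0r.
Qed.

Lemma coef_comp_scaleX (p : {poly F}) c i : (p \Po (c *: 'X))`_i = c ^+ i * p`_i.
Proof.
rewrite comp_polyE coef_sum; under eq_bigr => j _ do rewrite exprZn !coefZ coefXn.
have [lt_i|le_i] := ltnP i (size p).
  rewrite (bigD1 (Ordinal lt_i)) //= eqxx mulr1 mulrC big1 ?addr0 // => j ji.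
  by rewrite eq_sym (negPf (ji : (j : nat) != i)) !mulr0.
rewrite big1 => [|j _]; first by rewrite nth_default // mulr0.
by rewrite gtn_eqF ?mulr0 // (leq_trans (ltn_ord j)).
Qed.

(* If [N] and the palindromic polynomial [G] of [g] had no common root, [N * G(q ^+ 2 *: 'X) = R' * G]
   would force [G(q ^+ 2 *: 'X) = G], so [G = 1 + 'X^n'] with [n' = 2 deg g]; then
   [q^-1] is a common root, by the value of [R'] given by [stable_gauge]. *)
Lemma stable_root n' (g : {poly F}) : n'.-primitive_root (q ^+ 2) -> (1 < size g)%N -> (size g <= n')%N ->
  g %| B g -> g %| B ('X * g) ->
  exists2 y, y != 0 & N.[y] = 0 /\ g.[xof y] = 0.
Proof.
move=> prim g_gt1 g_le gB gXB; apply: NNPP => noroot.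
have g0 : g != 0 by rewrite -size_poly_gt0 ltnW.
have [r Eg] := closed_field_poly_normal g.
have l0 : lead_coef g != 0 by rewrite lead_coef_eq0.
have szg : size g = (size r).+1 by rewrite Eg size_scale // size_prod_XsubC.
set G := palin r; have [Gm szG] := palin_monic r; rewrite -/G in Gm szG.
have gG y : y != 0 -> y ^+ size r * g.[xof y] = lead_coef g * G.[y].
  by move=> y0; rewrite palinE // [in LHS]Eg hornerZ mulrCA.
have [R Rq HR] := stable_gauge g0 gB gXB.
(* Multiplication by powers of y turns g(y + 1/y) into G(y); the constant q^(2n), n = [size r],
   comes from (q^2 y)^n. *)
have NG : N * (G \Po (q ^+ 2 *: 'X)) = q ^+ (2 * size r) *: (R * G).
  apply: eq_poly_good => y gy; have /and5P [y0 _ _ _ _] := gy.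
  have qy0 : q ^+ 2 * y != 0 by rewrite mulf_neq0 ?expf_neq0.
  apply: (mulfI l0); rewrite hornerM horner_comp !hornerZ hornerX hornerM.
  rewrite mulrCA -gG // [in RHS]mulrCA [X in _ = _ * X]mulrCA -gG //.
  rewrite mulrCA HR // exprMn -exprM; ring.
have copNG : coprimep G N.
  apply/Pdiv.ClosedField.coprimepP => y Gy; apply/negP => /eqP Ny; apply: noroot.
  have y0 : y != 0.
    apply: contraL Gy => /eqP ->; rewrite rootE horner_coef0 palin_coef0.
    exact: oner_neq0.
  exists y => //; split=> //; apply: (mulfI (expf_neq0 (size r) y0)).
  by rewrite gG // (rootP Gy) !mulr0.
have GG : G \Po (q ^+ 2 *: 'X) = G.
  have : G %| G \Po (q ^+ 2 *: 'X).
    by rewrite -(Gauss_dvdpr _ copNG) NG scalerAl dvdp_mull.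
  have szGG : size G == size (G \Po (q ^+ 2 *: 'X)).
    rewrite size_comp_poly2 // size_scale ?expf_neq0 //.
    by rewrite size_polyX.
  move=> dvG; move: szGG; rewrite (dvdp_size_eqp dvG) => /eqp_eq; move: (Gm) => /monicP ->; rewrite scale1r => E.
  have := congr1 (fun p : {poly F} => p`_0) E.
  rewrite coefZ coef_comp_scaleX palin_coef0 expr0 !mulr1 => l1.
  by rewrite -E l1 scale1r.
have G0 : G != 0 by rewrite monic_neq0.
have n_gt0 : (0 < size r)%N by move: g_gt1; rewrite szg.
have n_lt : (size r < n')%N by rewrite -szg.
have Gfix i : q ^+ 2 ^+ i * G`_i = G`_i by rewrite -coef_comp_scaleX GG.
have Gtop : G`_(2 * size r) = 1 by have /monicP := Gm; rewrite /lead_coef szG.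
(* The coefficient of degree 2n is 1, so n' divides 2n, and 0 < n < n' leaves only n' = 2n. *)
have n'E : n' = (2 * size r)%N.
  have /eqP := Gfix (2 * size r)%N; rewrite Gtop mulr1 -(prim_order_dvd prim) => /dvdnP [[|[|m]] Em].
  - by move: n_gt0; rewrite -(ltn_pmul2l (isT : (0 < 2)%N)) Em.
  - by rewrite Em mul1n.
  - have : (2 * size r < 2 * n')%N by rewrite ltn_pmul2l.
    by rewrite Em ltn_mul2r /= ltnS andbF.
set Q := q ^+ (2 * size r) in NG.
have Q1 : Q != 1.
  rewrite /Q exprM -(prim_order_dvd prim); apply/negP => /(dvdn_leq n_gt0).
  by rewrite leqNgt n_lt.
have QN1 : Q = -1.
  have : Q ^+ 2 == 1 by rewrite /Q -n'E -exprM mulnC exprM (prim_expr_order prim).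
  by rewrite sqrf_eq1 (negPf Q1) => /eqP.
apply: noroot; exists q^-1; rewrite ?invr_eq0 //; split.
  (* Cancelling [G] gives N = Q R; as N and R agree at q^-1 and Q is not 1, [N] vanishes there. *)
  have NR : N = Q *: R by apply: (mulIf G0); rewrite -{1}GG NG scalerAl.
  have /eqP := congr1 (fun p => p.[q^-1]) NR; rewrite hornerZ Rq -subr_eq0 -{1}[N.[_]]mul1r -mulrBl.
  by rewrite mulf_eq0 subr_eq0 eq_sym (negPf Q1) => /eqP.
apply: (mulfI (expf_neq0 (size r) (_ : q^-1 != 0))); first by rewrite invr_eq0.
rewrite gG ?invr_eq0 // mulr0.
(* Only the two extreme coefficients of [G] survive, so G(q^-1) = 1 + 1/Q = 0. *)
rewrite horner_coef szG big_ord_recr /= Gtop mul1r exprVn -/Q QN1 invrN1.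
case: (2 * size r)%N n'E => [n'0 | m n'E].
  by move: n_lt; rewrite n'0.
rewrite big_ord_recl /= palin_coef0 expr0 mulr1 big1 ?addr0 ?subrr ?mulr0 // => i _.
have : (q ^+ 2 ^+ i.+1 - 1) * G`_i.+1 = 0 by rewrite mulrBl Gfix mul1r subrr.
move/eqP; rewrite mulf_eq0 subr_eq0 -(prim_order_dvd prim) n'E => /orP [/dvdn_leq|].
  by move=> /(_ isT); rewrite ltnS leqNgt ltn_ord.
by rewrite /bump add1n => /eqP ->; rewrite mul0r.
Qed.
End Gauge.

(** * Effect of the moves on the four parameters *)

Section Moves.
Variables (F : closedFieldType) (q : F).
Hypothesis q0 : q != 0.

Definition quad_unit (x : quad F) : bool :=
  let: (a, b, c, l) := x in [&& a != 0, b != 0, c != 0 & l != 0].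

Definition aw_data (x : quad F) : F * {poly F} :=
  let: (a, b, c, l) := x in (b / l, awN q a b c l).

(** The sign fixes all parameters; (1 2) swaps bq/c with bcq, (3 4) swaps a/lam with 1/(a lam), and
    (2 3) swaps bcq with 1/(a lam). *)
Lemma move_aw_data x y : move q x y -> aw_data x = aw_data y.
Proof.
case=> {x y} [a b c l|a b c l|a b c l|a b c l s] a0 b0 c0 l0; rewrite /aw_data /awN.
- have Ninv (u v : F) : v != 0 -> - u / - v = u / v by move=> v0; rewrite invrN mulrNN.
  by rewrite !Ninv // !mulrNN mulNr Ninv.
- rewrite invrK [b / c * q]mulrAC [b * c * q]mulrAC; congr (_, _); congr (_ * _); exact: mulrAC.
- rewrite !invfM invrK; congr (_, _).
  have sw (A B C D : {poly F}) : A * B * C * D = D * B * C * A by ring.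
  by rewrite sw.
move=> s2; have s0 : s != 0.
  by apply: contra_eq_neq s2 => ->; rewrite expr0n eq_sym /= !mulf_neq0.
have E1 (u v : F) : v != 0 -> u / s / (v / s) = u / v by move=> v0; field; rewrite s0 v0.
rewrite !E1 // [b / s * q]mulrAC E1 //; congr (_, _).
have -> : b / s * (c / s) * q = (a * l)^-1.
  have -> : b / s * (c / s) * q = b * c * q / s ^+ 2 by field.
  by rewrite s2; field; rewrite a0 b0 c0 l0 q0.
have -> : (a / s * (l / s))^-1 = b * c * q.
  have -> : (a / s * (l / s))^-1 = s ^+ 2 / (a * l) by field; rewrite a0 l0 s0.
  by rewrite s2; field; rewrite a0 l0.
by rewrite mulrAC.
Qed.

Lemma approx_aw_data x y : approx q x y -> aw_data x = aw_data y.
Proof.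
elim=> {x y} [x y|x|x y _ ->|x y z _ -> _ ->] //; exact: move_aw_data.
Qed.

Lemma sqrt_exists (u : F) : exists s, s ^+ 2 = u.
Proof.
have [|s Hs] := @solve_monicpoly F 2 (fun i => if i == 0%N then u else 0); first by [].
by exists s; rewrite Hs !big_ord_recl big_ord0 /= expr0 mulr1 mul0r !addr0.
Qed.

Lemma move_23_exists a b c l : quad_unit (a, b, c, l) -> exists s,
  [/\ s != 0, s ^+ 2 = a * b * c * l * q & approx q (a / s, b / s, c / s, l / s) (a, b, c, l)].
Proof.
move=> /and4P [a0 b0 c0 l0]; have [s Hs] := sqrt_exists (a * b * c * l * q).
have s0 : s != 0.
  by apply: contra_eq_neq Hs => ->; rewrite expr0n eq_sym /= !mulf_neq0.
exists s; split=> //; apply: rst_sym; apply: rst_step; exact: move_23.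
Qed.

Lemma quad_unit_div a b c l s :
  s != 0 -> quad_unit (a, b, c, l) -> quad_unit (a / s, b / s, c / s, l / s).
Proof. by move=> s0 /and4P [*]; rewrite /quad_unit !mulf_neq0 ?invr_eq0. Qed.

Lemma approx_12 a b c l : quad_unit (a, b, c, l) -> approx q (a, b, c^-1, l) (a, b, c, l).
Proof. by move=> /and4P [*]; apply: rst_sym; apply: rst_step; apply: move_12. Qed.

Lemma approx_34 a b c l : quad_unit (a, b, c, l) -> approx q (a^-1, b, c, l) (a, b, c, l).
Proof. by move=> /and4P [*]; apply: rst_sym; apply: rst_step; apply: move_34. Qed.

(** 1/y is one of the four parameters. Inverting c sends bq/c to bcq, (2 3) sends bcq to 1/(a lam),
    and inverting a sends that to a/lam. *)
Lemma approx_root a b c l y : quad_unit (a, b, c, l) -> y != 0 -> (awN q a b c l).[y] = 0 ->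
  exists x, [/\ quad_unit x, approx q x (a, b, c, l) & x.1.1.1 / x.2 = y^-1].
Proof.
have key a' b' c' l' : quad_unit (a', b', c', l') -> y != 0 -> b' * c' * q = y^-1 ->
  exists x, [/\ quad_unit x, approx q x (a', b', c', l') & x.1.1.1 / x.2 = y^-1].
  move=> u y0 Ey; have [s [s0 s2 A]] := move_23_exists u.
  have us := quad_unit_div s0 u.
  exists ((a' / s)^-1, b' / s, c' / s, l' / s); split=> /=.
  - by move: us; rewrite /= invr_eq0.
  - exact: rst_trans (approx_34 us) A.
  have /and4P [a0 b0 c0 l0] := u.
  rewrite -Ey invf_div; apply: (mulIf l0); apply: (mulIf a0).
  have -> : s / a' / (l' / s) * l' * a' = s ^+ 2 by field; rewrite a0 l0 s0.
  by rewrite s2; ring.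
move=> u y0; have /and4P [a0 b0 c0 l0] := u.
have root1 v : 1 - v * y = 0 -> v = y^-1.
  by move=> /eqP; rewrite subr_eq0 => /eqP E; apply: (mulIf y0); rewrite -E mulVf.
rewrite /awN !hornerE => /eqP; rewrite !mulf_eq0 => /orP [/orP [/orP []|]|] /eqP /root1 E.
- by exists (a, b, c, l); split=> //; apply: rst_refl.
- have u' : quad_unit (a, b, c^-1, l) by rewrite /quad_unit a0 b0 invr_eq0 c0 l0.
  have [|x [ux Ax Ex]] := key _ _ _ _ u' y0; first by rewrite -E mulrAC.
  by exists x; split=> //; apply: rst_trans Ax (approx_12 u).
- exact: key.
- exists (a^-1, b, c, l); split=> /=; [by rewrite invr_eq0 | exact: approx_34 |].
  by rewrite -E invfM.
Qed.

(** One of the last three factors of [phiS] vanishes. The first gives lam^2 = q^(2i) at once; for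
    the second, (2 3) keeps a/lam and replaces lam^2 by lam/(abcq) = q^(2i); the third is the second
    with c inverted. *)
Lemma approx_phi0 a b c l i : quad_unit (a, b, c, l) -> phi q a b c l i.+1 = 0 ->
  q ^+ (2 * i.+1) != 1 ->
  exists x, [/\ quad_unit x, approx q x (a, b, c, l), x.1.1.1 / x.2 = a / l & x.2 ^+ 2 = q ^+ (2 * i)].
Proof.
have key a' b' c' l' : quad_unit (a', b', c', l') -> 1 - a' * b' * c' * q / l' * q ^+ i ^+ 2 = 0 ->
  exists x, [/\ quad_unit x, approx q x (a', b', c', l'), x.1.1.1 / x.2 = a' / l' & x.2 ^+ 2 = q ^+ (2 * i)].
  move=> u E; have [s [s0 s2 A]] := move_23_exists u.
  have /and4P [a0 b0 c0 l0] := u.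
  exists (a' / s, b' / s, c' / s, l' / s); split=> //=; first exact: quad_unit_div.
    by field; rewrite s0 l0.
  rewrite mulnC exprM expr_div_n s2.
  move/eqP: E; rewrite subr_eq0 => /eqP E.
  rewrite -[LHS]mulr1 E; field.
  by rewrite a0 b0 c0 l0 q0.
move=> u; have /and4P [a0 b0 c0 l0] := u.
have r0 : q ^+ i != 0 by rewrite expf_neq0.
rewrite phiS // => /eqP P q1; move: P; rewrite !mulf_eq0 oppr_eq0 !invr_eq0 !mulf_eq0 !invr_eq0.
rewrite !expf_eq0 (negPf a0) (negPf b0) (negPf l0) (negPf q0) /=.
have -> : (q * q ^+ i - (q * q ^+ i)^-1 == 0) = false.
  apply: contraNF q1 => /eqP; rewrite -exprS => E.
  rewrite mulnC exprM expr2 -[X in X * _](subrK (q ^+ i.+1)^-1) E add0r mulVf //.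
  by rewrite expf_neq0.
rewrite ?andbF /= => /orP [/orP [] |].
- rewrite subr_eq0 => /eqP E; exists (a, b, c, l); split=> //=; first exact: rst_refl.
  by rewrite mulnC exprM -[LHS]mul1r E mulfVK ?expf_neq0.
- by move/eqP; apply: key.
move=> /eqP E; have u' : quad_unit (a, b, c^-1, l) by rewrite /quad_unit a0 b0 invr_eq0 c0 l0.
have [|x [ux Ax Ex Ex2]] := key _ _ _ _ u'; first by rewrite -E; field; rewrite c0 l0.
by exists x; split=> //; apply: rst_trans Ax (approx_12 u).
Qed.

End Moves.

(** * The order of q^2 and the closed form of [wpoly] *)

Section Chebyshev.
Variables (F : closedFieldType) (q : F) (d : nat).
Hypotheses (q_prim : d.-primitive_root q) (d_ok : d \notin [:: 1%N; 2%N; 4%N]).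

Let d_gt0 : (0 < d)%N := prim_order_gt0 q_prim.

Lemma prim_neq0 : q != 0.
Proof.
apply: contra_eq_neq (prim_expr_order q_prim) => ->.
by rewrite expr0n eqn0Ngt d_gt0 eq_sym oner_eq0.
Qed.

Lemma prim_q4 : q ^+ 4 != 1.
Proof.
rewrite -(prim_order_dvd q_prim); apply: contra d_ok => d4.
have d_le : (d <= 4)%N by apply: dvdn_leq d4.
by move: d_le d4 d_gt0; case: (d) => [|[|[|[|[|]]]]].
Qed.

Lemma dprime_prim : (dprime d).-primitive_root (q ^+ 2).
Proof.
have -> : dprime d = (d %/ gcdn 2 d)%N; last exact: exp_prim_root.
rewrite /dprime; case: ifP => odd_d.
  have /eqP -> : coprime 2 d by rewrite coprime2n.
  by rewrite divn1.
by rewrite -divn2 (gcdn_idPl _) // dvdn2 odd_d.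
Qed.

Lemma dprime_gt0 : (0 < dprime d)%N.
Proof. exact: prim_order_gt0 dprime_prim. Qed.

Lemma prod_sub_prim n (w u t : F) : n.-primitive_root w ->
  \prod_(k < n) (u - t * w ^+ k) = u ^+ n - t ^+ n.
Proof.
move=> w_prim; have [-> | t0] := eqVneq t 0.
  under eq_bigr do rewrite mul0r subr0.
  by rewrite prodr_const card_ord expr0n eqn0Ngt (prim_order_gt0 w_prim) subr0.
have := congr1 (fun p => p.[u / t] * t ^+ n) (factor_Xn_sub_1 w_prim).
rewrite hornerD hornerN hornerXn hornerC mulrBl mul1r expr_div_n mulfVK ?expf_neq0 // => <-.
rewrite big_mkord horner_prod -[in t ^+ n](card_ord n) -prodr_const -big_split /=.
apply: eq_bigr => k _; rewrite hornerXsubC mulrBl mulfVK //.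
by rewrite mulrC.
Qed.

(** Each factor is (1/y - z) (y - z) / (0 - z) with z = t q^(2k). Writing 0 - z lets [prod_sub_prim]
    evaluate all three products. *)
Lemma newton_dprime (t y : F) : t != 0 -> y != 0 ->
  (newton (fun i => xof (t * q ^+ (2 * i))) (dprime d)).[xof y]
  = y ^+ dprime d + y ^- dprime d - (t ^+ dprime d + t ^- dprime d).
Proof.
move=> t0 y0; set n := dprime d; have n0 : (0 < n)%N := dprime_gt0.
rewrite /newton horner_prod.
have zn0 k : t * (q ^+ 2) ^+ k != 0 by rewrite mulf_neq0 ?expf_neq0 ?prim_neq0.
under eq_bigr => k _.
  rewrite hornerXsubC exprM xofB // (_ : - _ = (y^-1 - t * (q ^+ 2) ^+ k) * (y - t * (q ^+ 2) ^+ k)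
    * (0 - t * (q ^+ 2) ^+ k)^-1); last first.
    have := zn0 k; move: (t * _) => z z0.
    have z0' : 0 - z != 0 by rewrite sub0r oppr_eq0.
    by field; rewrite ?sub0r ?oppr_eq0 ?z0 ?y0.
  over.
rewrite !big_split /= prodfV !(prod_sub_prim _ _ dprime_prim) -/n.
rewrite expr0n eqn0Ngt n0 /= exprVn.
have := expf_neq0 n t0; have := expf_neq0 n y0; move: (y ^+ n) (t ^+ n) => Y T Y0 T0.
have T0' : 0 - T != 0 by rewrite sub0r oppr_eq0.
by field; rewrite ?sub0r ?oppr_eq0 ?Y0 ?T0.
Qed.

Lemma theta_periodic (a lam : F) i : theta q a lam (dprime d + i) = theta q a lam i.
Proof.
rewrite !thetaE exprM exprD (prim_expr_order dprime_prim) mul1r -exprM //.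
Qed.

Lemma eq_wpoly (a lam a' lam' delta delta' : F) :
  a != 0 -> lam != 0 -> a' != 0 -> lam' != 0 ->
  delta + a ^+ dprime d / lam ^+ dprime d + lam ^+ dprime d / a ^+ dprime d
  = delta' + a' ^+ dprime d / lam' ^+ dprime d + lam' ^+ dprime d / a' ^+ dprime d ->
  wpoly q a lam d delta = wpoly q a' lam' d delta'.
Proof.
move=> a0 l0 a0' l0' E; apply: (@eq_poly_xof _ q prim_neq0) => y /and5P [y0 _ _ _ _].
rewrite /wpoly !hornerD !hornerN !hornerC.
rewrite (eq_newton (thetaE q a lam)) (eq_newton (thetaE q a' lam')).
rewrite !newton_dprime ?mulf_neq0 ?invr_eq0 // -!exprVn !invf_div !expr_div_n.
apply/eqP; rewrite -subr_eq0; apply/eqP; move/eqP: E; rewrite -subr_eq0 => /eqP E.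
rewrite -[RHS]oppr0 -E; ring.
Qed.

End Chebyshev.

(** * Invariance of [opB] under the moves, and both directions of the equivalence *)

Lemma opB_approx (F : closedFieldType) (q a b c l a' b' c' l' : F) : q != 0 ->
  quad_unit (a, b, c, l) -> quad_unit (a', b', c', l') ->
  approx q (a, b, c, l) (a', b', c', l') -> opB q a b c l =1 opB q a' b' c' l'.
Proof.
move=> q0 /and4P [a0 b0 c0 l0] /and4P [a0' b0' c0' l0'] /(approx_aw_data q0) /= [Ek EN].
apply: (is_aw_unique q0); first exact: opB_aw.
by rewrite Ek EN; apply: opB_aw.
Qed.

Lemma size_awN (F : closedFieldType) (q a b c l : F) : (size (awN q a b c l) <= 5)%N.
Proof.
have sz (t : F) : (size (1 - t *: 'X)%R <= 2)%N.
  rewrite (leq_trans (size_polyD _ _)) // geq_max size_poly1 size_polyN.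
  by rewrite (leq_trans (size_scale_leq _ _)) ?size_polyX.
have szM (u v : {poly F}) m :
    (size u <= m.+1)%N -> (size v <= 2)%N -> (size (u * v)%R <= m.+2)%N.
  move=> u_m v2; apply: leq_trans (size_polyMleq _ _) _.
  by have := leq_add u_m v2; rewrite addn2; case: (_ + _)%N.
by rewrite /awN; do 3!(apply: (szM _ _ _); last exact: sz); exact: sz.
Qed.

Theorem theorem1p11 (F : closedFieldType) (q : F) (d : nat)
    (a b c lam delta : F) :
  d.-primitive_root q -> d \notin [:: 1%N; 2%N; 4%N] ->
  a != 0 -> b != 0 -> c != 0 -> lam != 0 ->
  (W_irreducible q d a b c lam delta <->
   (forall ab bb cb lb db : F,
      ab != 0 -> bb != 0 -> cb != 0 -> lb != 0 ->
      simeq q d (ab, bb, cb, lb, db) (a, b, c, lam, delta) ->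
      db != 0 \/
      ~ (exists i : nat, (i.+2 <= dprime d)%N /\ lb ^+ 2 = q ^+ (2 * i)))).
Proof.
move=> q_prim d_ok a0 b0 c0 l0.
have q0 : q != 0 := prim_neq0 q_prim.
have q4 : q ^+ 4 != 1 := prim_q4 q_prim d_ok.
have q2_prim := dprime_prim q_prim.
have d'_gt0 := dprime_gt0 q_prim.
have u : quad_unit (a, b, c, lam) by rewrite /quad_unit a0 b0 c0.
have th_per a' l' i := theta_periodic q_prim a' l' i.
rewrite (W_irreducibleP b c delta (th_per a lam) d'_gt0).
split=> [irr ab bb cb lb db ab0 bb0 cb0 lb0 [appr Edelta] | bad g g_dvd g_st].
  (* If db = 0 and lb^2 = q^(2i), then [wpoly] is a full Newton polynomial for the moved quadruple,
     and its factor of degree i+1 < d' is stable. *)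
  have [db0|] := eqVneq db 0; [right | by left]; case=> i [lt_i lb2].
  have ub : quad_unit (ab, bb, cb, lb) by rewrite /quad_unit ab0 bb0 cb0.
  have EP : wpoly q a lam d delta = newton (theta q ab lb) (dprime d).
    by rewrite -(eq_wpoly q_prim ab0 lb0 a0 l0 Edelta) db0 /wpoly subr0.
  have phi_0 : phi q ab bb cb lb i.+1 = 0.
    rewrite phiS // -exprM mulnC lb2 mulfV ?expf_neq0 // subrr mulr0 !mul0r //.
  have [|p /dvdpP [h ->]|sz1|] := irr (newton (theta q ab lb) i.+1).
  - by rewrite EP -(subnKC (ltnW lt_i)) newton_add dvdp_mulr.
  - rewrite -(opB_approx q0 ub u appr) mulrC.
    by have := opB_newton_mul q ab bb cb lb i.+1 h; rewrite phi_0 mul0r scale0r subr0.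
  - by rewrite size_newton in sz1.
  move=> /dvdp_leq; rewrite monic_neq0 ?newton_monic // size_wpoly // size_newton => /(_ isT).
  by rewrite ltnS leqNgt lt_i.
have g0 : g != 0.
  apply: contraTneq g_dvd => ->; rewrite dvd0p -size_poly_eq0 size_wpoly //.
have wp0 : wpoly q a lam d delta != 0 by rewrite -size_poly_eq0 size_wpoly.
have [|sz_g1] := eqVneq (size g) 1%N; [by left | right].
apply/negPn/negP => ndvd.
have sz_gt1 : (1 < size g)%N by rewrite ltn_neqAle eq_sym sz_g1 size_poly_gt0.
have sz_le : (size g <= dprime d)%N.
  have := dvdp_leq wp0 g_dvd; rewrite size_wpoly // leq_eqVlt ltnS => /orP [sz_eq|//].
  by case/negP: ndvd; rewrite (eqp_dvdl _ (_ : _ %= g)) // eqp_sym -dvdp_size_eqp // size_wpoly.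
have gB : g %| opB q a b c lam g by apply: g_st.
have gXB : g %| opB q a b c lam ('X * g) by apply: g_st; rewrite dvdp_mull.
have k0 : b / lam != 0 by rewrite mulf_neq0 ?invr_eq0.
have [y y0 [Ny gy]] := stable_root q0 q4 k0 (size_awN q a b c lam) (opB_aw q0 a0 b0 c0 l0)
  (size_opB _ _ _ _ _) q2_prim sz_gt1 sz_le gB gXB.
have [[[[a' b'] c'] l'] [u' appr /= Ey]] := approx_root q0 u y0 Ny.
have /and4P [a0' b0' c0' l0'] := u'.
pose n := dprime d.
(* [de] is chosen to preserve the invariant tau, hence [wpoly]. *)
pose de := delta + a ^+ n / lam ^+ n + lam ^+ n / a ^+ n - a' ^+ n / l' ^+ n - l' ^+ n / a' ^+ n.
have Ede : de + a' ^+ n / l' ^+ n + l' ^+ n / a' ^+ n = delta + a ^+ n / lam ^+ n + lam ^+ n / a ^+ n.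
  by rewrite /de; ring.
have EP : wpoly q a' l' d de = wpoly q a lam d delta by apply: eq_wpoly.
have th0 : theta q a' l' 0 = xof y by rewrite thetaE muln0 mulr1 Ey xofV.
(* The first node is [xof y], a root of [g] and so of [wpoly]; there the Newton polynomial vanishes,
   leaving -de. *)
have de0 : de = 0.
  have : root (wpoly q a' l' d de) (xof y).
    by rewrite -dvdp_XsubCl EP (dvdp_trans _ g_dvd) // dvdp_XsubCl rootE gy.
  rewrite rootE /wpoly hornerD hornerN hornerC -th0 newton_root // sub0r oppr_eq0.
  by move=> /eqP.
set th := theta q a' l' in th0.
have ex_r : exists r, newton th r %| g by exists 0%N; rewrite newton0 dvd1p.
have r_le r : newton th r %| g -> (r < size g)%N.
  by move=> /(dvdp_leq g0); rewrite size_newton.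
have [r r_dvd r_max] := ex_maxnP ex_r (fun r H => ltnW (r_le r H)).
have r_gt0 : (0 < r)%N.
  by apply: r_max; rewrite newtonS newton0 mul1r th0 dvdp_XsubCl rootE gy.
have /dvdpP [h Eg] := r_dvd.
have h_r : h.[th r] != 0.
  apply/negP => hr; have : (r < r)%N; last by rewrite ltnn.
  by apply: r_max; rewrite newtonS Eg mulrC dvdp_mul // dvdp_XsubCl.
(* Otherwise [newton th r] would divide [newton th r.-1], which has smaller degree. *)
have phi_r : phi q a' b' c' l' r = 0.
  have gB' : newton th r %| opB q a' b' c' l' g.
    by rewrite (opB_approx q0 u' u appr); apply: dvdp_trans gB.
  have := opB_newton_mul q a' b' c' l' r h.
  rewrite -/th [newton th r * h]mulrC -Eg dvdp_subr // => H.
  apply/eqP/negPn/negP => phi_n0; move: H; rewrite (dvdpZr _ _ (mulf_neq0 phi_n0 h_r)) => H.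
  have := dvdp_leq _ H; rewrite !size_newton monic_neq0 ?newton_monic // => /(_ isT).
  by case: (r) r_gt0 => // m _; rewrite ltnn.
case: r r_gt0 phi_r {h_r r_max Eg} r_dvd => // i _ phi_i /r_le lt_i.
have [|[[[a2 b2] c2] l2] [u2 appr2 /= E2 l22]] := approx_phi0 q0 u' phi_i.
  rewrite exprM -(prim_order_dvd q2_prim); apply/negP => /dvdn_leq.
  by move=> /(_ isT); rewrite leqNgt (leq_trans lt_i sz_le).
have /and4P [a02 b02 c02 l02] := u2.
case: (bad a2 b2 c2 l2 0) => //; first last.
- by case; exists i; split=> //; apply: leq_trans sz_le.
- by rewrite eqxx.
(* The last move keeps a/lam, so tau is still matched by delta = 0. *)
split; first exact: rst_trans appr2 appr.
rewrite -Ede de0 -/n -!expr_div_n -[l2 / a2]invf_div -[l' / a']invf_div.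
by rewrite E2.
Qed.
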